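(* If $X$ is a nondegenerate dart taking values in $\mathbb{R}^n$ which has a single point mass, then there exists a nonnegative continuous payoff function $f$ on $\mathbb{R}^n$ with compact support such that $(X,f)$ is not reasonable.
   Context: A dart is a random vector $X$ taking values in $\mathbb{R}^n$. A point mass of $X$ is a point $x$ with $P(X=x)>0$; having a single point mass means there is exactly one such $x$. Nondegenerate means that the distribution is not a single point mass of weight one (i.e. $X$ is not almost surely constant). A payoff function is a measurable function $f:\mathbb{R}^n\to\mathbb{R}$ bounded from above. For $d>0$, $g_{X,f}(d):=\sup_{a\in\mathbb{R}^n}Ef(a+dX)$. The pair $(X,f)$ is reasonable if $g_{X,f}(d)$ is decreasing (i.e. non-increasing) in $d\in(0,\infty)$. *)

(* Defs.v *)
From HB Require Import structures.
From mathcomp Require Import all_boot all_order all_algebra.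
From mathcomp Require Import all_classical all_reals all_analysis.

Set Implicit Arguments.
Unset Strict Implicit.
Unset Printing Implicit Defensive.

Import Order.TTheory GRing.Theory Num.Theory.
Import numFieldNormedType.Exports.

Local Open Scope classical_set_scope.
Local Open Scope ring_scope.

(* R^n as a measurable space: row vectors with the Borel sigma-algebra of the
   product topology (the library puts no measurable structure on matrices).
   [g_sigma_algebraType] is an identity alias, so [borel_rV R n] is convertible
   to ['rV[R]_n]. *)
Definition borel_rV (R : realType) (n : nat) :=
  g_sigma_algebraType (@open 'rV[R]_n).

Section dart.
Context {d : measure_display} {Omega : measurableType d} {R : realType}.
Context {P : probability Omega R} {n : nat}.
Implicit Type X : {RV P >-> borel_rV R n}.

Definition point_mass X (x : 'rV[R]_n) : Prop :=
  (0 < P (X @^-1` [set x]))%E.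

Definition single_point_mass X : Prop := exists! x : 'rV[R]_n, point_mass X x.

Definition nondegenerate_dart X : Prop :=
  ~ exists x : 'rV[R]_n, P (X @^-1` [set x]) = 1%E.

(* The expectation of a payoff may be -oo, hence the value in [\bar R]. *)
Definition best_payoff X (f : 'rV[R]_n -> R) (t : R) : \bar R :=
  ereal_sup (range (fun a : 'rV[R]_n =>
    'E_P[fun w => f (a + t *: (X w : 'rV[R]_n))%R]%E)).

Definition reasonable X (f : 'rV[R]_n -> R) : Prop :=
  forall s t : R, 0 < s -> s <= t ->
    (best_payoff X f t <= best_payoff X f s)%E.

End dart.

Definition payoff (R : realType) (n : nat) (f : 'rV[R]_n -> R) : Prop :=
  measurable_fun [set: borel_rV R n] f /\ has_ubound (range f).

Definition compact_support (R : realType) (n : nat) (f : 'rV[R]_n -> R) : Prop :=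
  compact (closure [set x | f x != 0]).

(* Main.v *)
Require Import Defs.
From HB Require Import structures.
From mathcomp Require Import all_boot all_order all_algebra.
From mathcomp Require Import all_classical all_reals all_analysis.
From mathcomp Require Import measurable_realfun ring lra.
Import Order.TTheory GRing.Theory Num.Theory.
Import numFieldNormedType.Exports.
Local Open Scope classical_set_scope.
Local Open Scope ring_scope.

(** Let [x0] be the unique atom of [X], let [p] in ]0, 1[ be its weight, and
    let [e = p (1 - p) / 4].  The payoff is radial: a spike of height 1 on a
    tiny ball of radius [delta] around the target 0, and a plateau of height
    only [p] on a wide annulus [r <= |x| <= M], with a gap of value 0 between
    the two.

    With the large scale [t = 1], the player aims the atom at the spike, and
    the rest of the distribution lands almost entirely on the plateau as soon
    as the annulus is wide enough ([punctured_tail_small]).  The payoff is at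
    least [p + (1 - p) p - e] ([coarse_scale_payoff]).

    With a small scale [s], the player cannot collect both.  Wherever he aims,
    the non-atomic part of the scaled dart hits the spike with probability at
    most [e] when [delta] is small, because a distribution without atoms gives
    uniformly small mass to small balls ([small_ball]).  If the atom misses the
    spike, everything but that event pays at most the plateau height [p].  If
    the atom hits the spike, then at so small a scale almost all the rest lands
    short of the plateau, and the payoff comes mainly from the atom, of weight
    [p].  In both cases the payoff is at most [p + 2 e] ([fine_scale_payoff]),
    which is less than the payoff at scale 1 since [3 e < p (1 - p)].

    The constants are chosen in the order [r, M], then [s], then [delta]. *)

(** * Measurability *)

(** The measurability of [Z] is expressed through preimages of open sets so that
    it applies to both a random vector and the identity of the Borel space. *)
Lemma measurable_fun_continuous_comp {d : measure_display}
    {T : measurableType d} {R : realType} {V : topologicalType}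
    {Z : T -> V} {g : V -> R} :
  (forall U, open U -> measurable (Z @^-1` U)) -> continuous g ->
  measurable_fun [set: T] (g \o Z).
Proof.
move=> mZ /continuousP cg.
apply: (measurability (@RGenOpens.G R)).
  exact: RGenOpens.measurableE.
move=> _ [_ [a [b ->]] <-]; rewrite setTI comp_preimage.
exact/mZ/cg/interval_open.
Qed.

Lemma continuous_dist {R : realType} {n : nat} (x : 'rV[R]_n) :
  continuous (fun y : 'rV[R]_n => `|y - x|).
Proof.
move=> y; apply: (@cvg_norm _ _ _ (nbhs y)).
by apply: (@cvgB _ _ _ (nbhs y)); [exact: cvg_id|exact: cvg_cst].
Qed.

Lemma measurable_dist {d : measure_display} {T : measurableType d}
    {R : realType} {n : nat} {Z : T -> 'rV[R]_n} :
  (forall U, open U -> measurable (Z @^-1` U)) ->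
  forall (x : 'rV[R]_n) (B : set R), measurable B ->
  measurable [set w | B `|Z w - x|].
Proof.
move=> mZ x B mB.
have := measurable_fun_continuous_comp mZ (continuous_dist x) measurableT _ mB.
by rewrite setTI.
Qed.

Lemma measurable_preimage_set1 {d : measure_display} {T : measurableType d}
    {R : realType} {n : nat} {Z : T -> 'rV[R]_n} (x : 'rV[R]_n) :
  (forall U, open U -> measurable (Z @^-1` U)) -> measurable (Z @^-1` [set x]).
Proof.
move=> mZ.
rewrite (_ : _ @^-1` _ = [set w | [set 0] `|Z w - x|]).
  exact: measurable_dist.
apply/seteqP; split => w /= => [->|/normr0_eq0/eqP].
  by rewrite subrr normr0.
by rewrite subr_eq0 => /eqP.
Qed.

Lemma measurable_fun_payoff {d : measure_display} {T : measurableType d}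
    {R : realType} {n : nat} {Z : T -> 'rV[R]_n} {f : 'rV[R]_n -> R}
    (a : 'rV[R]_n) (t : R) :
  (forall U, open U -> measurable (Z @^-1` U)) -> continuous f ->
  measurable_fun [set: T] (fun w => f (a + t *: Z w)).
Proof.
move=> mZ cf.
have cg : continuous (fun x : 'rV[R]_n => f (a + t *: x)).
  move=> x; apply: (@continuous_comp _ _ _ (fun x : 'rV[R]_n => a + t *: x));
    last exact: cf.
  apply: (@cvgD _ _ _ (nbhs x)); first exact: cvg_cst.
  by apply: (@cvgZr _ _ _ (nbhs x)); exact: cvg_id.
exact: measurable_fun_continuous_comp mZ cg.
Qed.

(** The distance 0 is excluded: the events of this form shrink to the empty set
    as the annulus grows, whether or not [x] is an atom. *)
Definition outside_annulus {T : Type} {R : realType} {n : nat}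
    (Z : T -> 'rV[R]_n) (x : 'rV[R]_n) (r M : R) : set T :=
  [set w | 0 < `|Z w - x| /\ (`|Z w - x| < r \/ M < `|Z w - x|)].

Lemma measurable_outside_annulus {d : measure_display} {T : measurableType d}
    {R : realType} {n : nat} {Z : T -> 'rV[R]_n} (x : 'rV[R]_n) (r M : R) :
  (forall U, open U -> measurable (Z @^-1` U)) ->
  measurable (outside_annulus Z x r M).
Proof.
move=> mZ.
have -> : outside_annulus Z x r M = [set w |
    (`]0, +oo[ `&` (`]-oo, r[ `|` `]M, +oo[))%classic `|Z w - x|].
  by apply/seteqP; split => w /=; rewrite !in_itv/= ?andbT.
by apply: measurable_dist => //; apply: measurableI => //; apply: measurableU.
Qed.

(** * Small probabilities *)

(** The complements of the annuli [1/(k+1) <= |z - x| <= k+1], deprived of [x],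
    decrease to the empty set, so that continuity from above applies. *)
Lemma punctured_tail_small {d : measure_display} {T : measurableType d}
    {R : realType} {P : probability T R} {n : nat} {Z : T -> 'rV[R]_n} :
  (forall U, open U -> measurable (Z @^-1` U)) ->
  forall (x : 'rV[R]_n) (e : R), 0 < e ->
  exists r M, [/\ 0 < r, r <= M & (P (outside_annulus Z x r M) < e%:E)%E].
Proof.
move=> mZ x e e0.
pose F k := outside_annulus Z x k.+1%:R^-1 k.+1%:R.
have mF k : measurable (F k) by exact: measurable_outside_annulus.
have F0 : \bigcap_k F k = set0.
  apply/seteqP; split => // w Fw.
  have [|w0 _] := Fw 0%N; first by [].
  (* [Num.bound N] exceeds both the distance and its inverse. *)
  pose N := `|Z w - x| + `|Z w - x|^-1.
  have N0 : 0 <= N by rewrite addr_ge0// invr_ge0.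
  have [|_ []] := Fw (Num.bound N) => //.
    apply/negP; rewrite -leNgt invf_ple ?posrE//.
    apply/ltW/(le_lt_trans _ (lt_trans (archi_boundP N0) _)); last first.
      by rewrite ltr_nat.
    by rewrite lerDr.
  apply/negP; rewrite -leNgt.
  apply/ltW/(le_lt_trans _ (lt_trans (archi_boundP N0) _)); last first.
    by rewrite ltr_nat.
  by rewrite lerDl invr_ge0.
have : P \o F @ \oo --> P (\bigcap_k F k).
  apply: nonincreasing_cvg_mu => //.
  - by rewrite (le_lt_trans (probability_le1 P (mF 0%N)))// ltry.
  - exact: bigcapT_measurable.
  - move=> k l kl; rewrite subsetEset => w [w0 wl]; split => //.
    case: wl => [wl|wl]; [left|right].
      by apply: lt_le_trans wl _; rewrite lef_pV2 ?posrE// ler_nat.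
    by apply: le_lt_trans wl; rewrite ler_nat.
rewrite F0 measure0 => cF.
have /cF[k _ /(_ k (leqnn k)) /= Fk] : nbhs 0%E [set u | u < e%:E]%E.
  by apply: open_ereal_lt'; rewrite lte_fin.
exists k.+1%:R^-1, k.+1%:R; split => //.
by rewrite (@le_trans _ _ 1)// ?ler1n// invf_le1// ler1n.
Qed.

Lemma measurable_punctured_ball {d : measure_display} {T : measurableType d}
    {R : realType} {n : nat} {Z : T -> 'rV[R]_n} (x0 a : 'rV[R]_n) (delta : R) :
  (forall U, open U -> measurable (Z @^-1` U)) ->
  measurable [set w | Z w != x0 /\ `|Z w - a| < delta].
Proof.
move=> mZ.
have -> : [set w | Z w != x0 /\ `|Z w - a| < delta] =
   [set w | `]0, +oo[%classic `|Z w - x0|] `&`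
   [set w | `]-oo, delta[%classic `|Z w - a|].
  by apply/seteqP; split => w /=; rewrite !in_itv/= ?andbT normr_gt0 subr_eq0.
by apply: measurableI; exact: measurable_dist.
Qed.

(** A distribution without atoms other than [x0], deprived of [x0], has a
    concentration function that tends to 0.  Around each centre some ball is
    light by [punctured_tail_small]; it controls all smaller balls with nearby
    centres, so compactness yields a radius valid for all centres in a closed
    ball, and balls centred further away lie in the tail of the distribution. *)
Lemma small_ball {d : measure_display} {T : measurableType d}
    {R : realType} {P : probability T R} {n : nat} {Z : T -> 'rV[R]_n}
    (x0 : 'rV[R]_n) :
  (forall U, open U -> measurable (Z @^-1` U)) ->
  (forall x, x != x0 -> P (Z @^-1` [set x]) = 0%E) ->
  forall e : R, 0 < e -> exists2 delta : R, 0 < delta &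
    forall a, (P [set w | Z w != x0 /\ (`|Z w - a| < delta)%R] <= e%:E)%E.
Proof.
move=> mZ noatom e e0.
have mball a delta := measurable_punctured_ball x0 a delta mZ.
have [r [M [r0 rM PM]]] := punctured_tail_small mZ x0 e e0 (P := P).
pose K := [set x : 'rV[R]_n | `|x - x0| <= M + 1].
have cK : compact K.
  apply: bounded_closed_compact.
    exists (M + 1 + `|x0|); split; first exact: num_real.
    move=> y My x /= Kx; apply/ltW/le_lt_trans/My.
    by rewrite -{1}(subrK x0 x) (le_trans (ler_normD _ _))// lerD2r.
  rewrite (_ : K = (fun y : 'rV[R]_n => `|y - x0|) @^-1` `]-oo, M + 1]%classic).
    apply: closed_comp => [y _|]; last exact: interval_closed.
    exact: continuous_dist.
  by apply/seteqP; split => y /=; rewrite in_itv.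
have local x : K x -> \forall x' \near x & delta \near 0^'+,
    (P [set w | Z w != x0 /\ (`|Z w - x'| < delta)%R] <= e%:E)%E.
  move=> _.
  have [s [M' [s0 _ Ps]]] := punctured_tail_small mZ x e e0 (P := P).
  have PxE : P ([set w | Z w != x0 /\ Z w = x]) = 0%E.
    have [->|xx0] := eqVneq x x0.
      rewrite (_ : [set w | _] = set0) ?measure0//.
      by apply/seteqP; split => // w [/eqP].
    rewrite -(noatom _ xx0); congr (P _).
    by apply/seteqP; split => w /= => [[]//|->].
  have mx : measurable [set w | Z w != x0 /\ Z w = x].
    rewrite (_ : [set w | _] = [set w | `]0, +oo[%classic `|Z w - x0|] `&`
      [set w | [set 0] `|Z w - x|]); last first.
      apply/seteqP; split => w /=; rewrite in_itv/= andbT normr_gt0 subr_eq0.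
        by move=> [-> ->]; rewrite subrr normr0.
      by move=> [-> /normr0_eq0/eqP]; rewrite subr_eq0 => /eqP ->.
    by apply: measurableI; exact: measurable_dist.
  near=> x' delta => /=.
  apply: (@le_trans _ _ (P ([set w | Z w != x0 /\ Z w = x] `|`
                            outside_annulus Z x s M'))).
    apply: le_measure; rewrite ?inE//.
      by apply: measurableU => //; exact: measurable_outside_annulus.
    move=> w /= [Zx0 Zx'].
    have [Zx|Zx] := eqVneq (Z w) x; first by left.
    right; split; first by rewrite normr_gt0 subr_eq0.
    left; rewrite -(subrKA x') (le_lt_trans (ler_normD _ _))//.
    rewrite (splitr s) ltrD//.
      apply: lt_le_trans Zx' _; near: delta.
      exact: nbhs_right_le (divr_gt0 _ _).
    rewrite distrC; near: x'; apply: cvgr_dist_lt => //.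
    exact: divr_gt0.
  apply: le_trans (measureU2 P mx (measurable_outside_annulus x s M' mZ)) _.
  by rewrite -[leRHS]add0e; apply: leeD; [rewrite -PxE|exact: ltW].
have Kdelta : \forall delta \near 0^'+, K `<=` (fun a =>
    P [set w | Z w != x0 /\ (`|Z w - a| < delta)%R] <= e%:E)%E.
  by move/compact_near_coveringP : cK; apply.
near (0 : R)^'+ => delta.
have Ksmall : K `<=` (fun a =>
    P [set w | Z w != x0 /\ (`|Z w - a| < delta)%R] <= e%:E)%E.
  by near: delta.
exists delta => // a.
have [/Ksmall//|Ka] := pselect (K a).
apply: le_trans (ltW PM); apply: le_measure; rewrite ?inE//.
  exact: measurable_outside_annulus.
move=> w /= [Zx0 Za]; split; first by rewrite normr_gt0 subr_eq0.
right.
have delta1 : delta <= 1 by near: delta; exact: nbhs_right_le.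
move/negP : Ka; rewrite /K/= -ltNge -(subrKA (Z w)) => Ka.
have := lt_le_trans Ka (ler_normD _ _).
rewrite (distrC a); lra.
Unshelve. all: by end_near. Qed.

(** * Expectations *)

Lemma measurable_funD_indic {d : measure_display} {T : measurableType d}
    {R : realType} {h : T -> R} {A : set T} {k : R} :
  measurable_fun [set: T] h -> measurable A ->
  measurable_fun [set: T] (fun w => h w + k * \1_A w).
Proof.
move=> mh mA; apply: (@measurable_funD _ _ _ _ h (fun w => k * \1_A w)) => //.
exact: (@measurable_funM _ _ _ _ (cst k) \1_A).
Qed.

Lemma expectationD_indic {d : measure_display} {T : measurableType d}
    {R : realType} {P : probability T R} {h : T -> R} {A : set T} {k : R} :
  measurable_fun [set: T] h -> (forall w, 0 <= h w) -> measurable A -> 0 <= k ->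
  ('E_P[fun w => (h w + k * \1_A w)%R] = 'E_P[h] + k%:E * P A)%E.
Proof.
move=> mh h0 mA k0; rewrite !unlock.
under eq_integral do rewrite EFinD.
rewrite ge0_integralD//=; last 4 first.
- by move=> w _; rewrite lee_fin.
- exact/measurable_EFinP.
- by move=> w _; rewrite lee_fin mulr_ge0.
- by apply/measurable_EFinP/measurable_funM => //; exact: measurable_indic.
congr (_ + _)%E.
under eq_integral do rewrite EFinM.
rewrite ge0_integralZl_EFin//=; last first.
  by apply/measurable_EFinP; exact: measurable_indic.
by rewrite integral_indic// setIT.
Qed.

Lemma le_expectation {d : measure_display} {T : measurableType d}
    {R : realType} {P : probability T R} {h g : T -> R} :
  measurable_fun [set: T] h -> measurable_fun [set: T] g ->
  (forall w, 0 <= h w <= g w) -> ('E_P[h] <= 'E_P[g])%E.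
Proof.
move=> mh mg hg; apply: expectation_le => //.
- by move=> w; have /andP[] := hg w.
- by move=> w; have /andP[] := hg w; exact: le_trans.
- by apply: aeW => w; have /andP[] := hg w.
Qed.

(** * The radial profile of the payoff *)

(** A spike on [0, delta[ and a trapezoid of height [p], which rises on
    [r / 2, r], is flat on [r, M] and falls on [M, M + 1]. *)
Definition spike_and_hump {R : realType} (p delta r M u : R) : R :=
  Num.max (Num.max 0 (1 - u / delta))
    (p * Num.max 0 (Num.min (u / (r / 2) - 1) (Num.min 1 (M + 1 - u)))).

Lemma continuous_spike_and_hump {R : realType} (p delta r M : R) :
  continuous (spike_and_hump p delta r M).
Proof.
move=> u.
have cst (c : R) : {for u, continuous (fun=> c)} by exact: cvg_cst.
have cid : {for u, continuous (fun v : R => v)} by exact: cvg_id.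
have cspike : {for u, continuous (fun v : R => 1 - v / delta)}.
  by apply: cvgB; [exact: cst|exact: cvgMl].
have crise : {for u, continuous (fun v : R => v / (r / 2) - 1)}.
  by apply: cvgB; [exact: cvgMl|exact: cst].
have cfall : {for u, continuous (fun v : R => M + 1 - v)}.
  by apply: cvgB; [exact: cst|exact: cid].
have chump := continuous_max (cst 0)
  (continuous_min crise (continuous_min (cst 1) cfall)).
exact: (continuous_max (continuous_max (cst 0) cspike) (cvgMr (a := p) chump)).
Qed.

Lemma spike_and_hump_ge0 {R : realType} (p delta r M u : R) :
  0 <= spike_and_hump p delta r M u.
Proof. by rewrite /spike_and_hump !le_max lexx. Qed.

Lemma spike_and_hump_le1 {R : realType} (p delta r M u : R) :
  0 <= p <= 1 -> 0 < delta -> 0 <= u -> spike_and_hump p delta r M u <= 1.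
Proof.
move=> /andP[p0 p1] delta0 u0; rewrite /spike_and_hump !ge_max ler01/=.
apply/andP; split; first by rewrite gerBl divr_ge0// ltW.
apply: mulr_ile1 => //; first by rewrite le_max lexx.
by rewrite ge_max ler01/= !ge_min lexx orbT.
Qed.

Lemma spike_and_hump0 {R : realType} (p delta r M : R) :
  0 <= p -> 0 < delta -> 1 <= spike_and_hump p delta r M 0.
Proof.
by move=> p0 delta0; rewrite /spike_and_hump !le_max mul0r subr0 lexx orbT.
Qed.

Lemma spike_and_hump_le {R : realType} (p delta r M u : R) :
  0 <= p -> 0 < delta -> delta <= u -> spike_and_hump p delta r M u <= p.
Proof.
move=> p0 delta0 deltau; rewrite /spike_and_hump !ge_max p0/=.
apply/andP; split.
  by rewrite (le_trans _ p0)// subr_le0 ler_pdivlMr// mul1r.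
by rewrite ler_piMr// ge_max ler01/= !ge_min lexx orbT.
Qed.

Lemma spike_and_hump_annulus {R : realType} (p delta r M u : R) :
  0 < r -> 0 <= p -> r <= u <= M -> p <= spike_and_hump p delta r M u.
Proof.
move=> r0 p0 /andP[ru uM]; rewrite /spike_and_hump le_max; apply/orP; right.
rewrite ler_peMr// !le_max !le_min lexx/=; apply/orP; right.
apply/andP; split; last lra.
by rewrite lerBrDr ler_pdivlMr ?divr_gt0//; lra.
Qed.

Lemma spike_and_hump_gap {R : realType} (p delta r M u : R) :
  0 < r -> 0 < delta -> delta <= u <= r / 2 ->
  spike_and_hump p delta r M u = 0.
Proof.
move=> r0 delta0 /andP[du ur]; rewrite /spike_and_hump.
have -> : Num.max 0 (1 - u / delta) = 0.
  by apply/max_idPl; rewrite subr_le0 ler_pdivlMr// mul1r.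
suff -> : Num.max 0 (Num.min (u / (r / 2) - 1) (Num.min 1 (M + 1 - u))) = 0.
  by rewrite mulr0 maxxx.
apply/max_idPl; rewrite ge_min subr_le0 ler_pdivrMr ?divr_gt0// mul1r.
by rewrite ur.
Qed.

Lemma spike_and_hump_far {R : realType} (p delta r M u : R) :
  0 < delta -> delta <= u -> M + 1 <= u -> spike_and_hump p delta r M u = 0.
Proof.
move=> delta0 du Mu; rewrite /spike_and_hump.
have -> : Num.max 0 (1 - u / delta) = 0.
  by apply/max_idPl; rewrite subr_le0 ler_pdivlMr// mul1r.
suff -> : Num.max 0 (Num.min (u / (r / 2) - 1) (Num.min 1 (M + 1 - u))) = 0.
  by rewrite mulr0 maxxx.
by apply/max_idPl; rewrite !ge_min (subr_le0 u) Mu !orbT.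
Qed.

(** * Payoffs at two scales *)

(** The atom is aimed at 0 and earns 1 there; whatever falls in the annulus
    earns [p]. *)
Lemma coarse_scale_payoff {d : measure_display} {T : measurableType d}
    {R : realType} {P : probability T R} {n : nat} {Z : T -> 'rV[R]_n}
    {f : 'rV[R]_n -> R} {p r M : R} (x0 : 'rV[R]_n) :
  (forall U, open U -> measurable (Z @^-1` U)) -> continuous f ->
  (forall x, 0 <= f x) -> 0 <= p <= 1 -> 1 <= f 0 ->
  (forall x, r <= `|x| <= M -> p <= f x) ->
  (p%:E + (1 - p)%:E * P (Z @^-1` [set x0]) <=
    'E_P[fun w => f (- x0 + 1 *: Z w)%R] + P (outside_annulus Z x0 r M))%E.
Proof.
move=> mZ cf f_ge0 /andP[p0 p1] f0 f_annulus.
have mG := measurable_outside_annulus x0 r M mZ.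
have mA := measurable_preimage_set1 x0 mZ.
have mf := measurable_fun_payoff (- x0) 1 mZ cf.
set G := outside_annulus Z x0 r M in mG *.
have -> : (p%:E + (1 - p)%:E * P (Z @^-1` [set x0]) =
    'E_P[fun w => (cst p w + (1 - p) * \1_(Z @^-1` [set x0]) w)%R])%E.
  by rewrite expectationD_indic ?expectation_cst// subr_ge0.
rewrite -[P G]mul1e -expectationD_indic//.
apply: le_expectation => [||w].
- exact: measurable_funD_indic.
- exact: measurable_funD_indic.
apply/andP; split; first by rewrite /= addr_ge0 ?mulr_ge0 ?subr_ge0.
rewrite scale1r /= mul1r !indicE.
have [|] := boolP (w \in Z @^-1` _); rewrite ?inE ?notin_setE /= => Zx0.
  by rewrite mulr1 subrKC Zx0 addNr ler_wpDr.
rewrite mulr0 addr0.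
have [Gw|] := boolP (w \in G); first by rewrite (le_trans p1)// lerDr.
rewrite notin_setE => nGw; rewrite addr0 (addrC (- x0)); apply: f_annulus.
have Zgt0 : 0 < `|Z w - x0| by rewrite normr_gt0 subr_eq0; exact/eqP.
apply/andP; split; rewrite leNgt; apply/negP => Zr; apply: nGw; split => //.
  by left.
by right.
Qed.

(** Either the aimed point [b] of the atom is off the spike, and then the payoff
    exceeds [p] only when the rest hits the spike; or [b] is on the spike, and
    then the rest falls in the gap unless it hits the spike or leaves the
    annulus.  The ball of centre [- a / s] and radius [eta] is what the spike
    becomes in the coordinates of the unscaled dart. *)
Lemma fine_scale_payoff {d : measure_display} {T : measurableType d}
    {R : realType} {P : probability T R} {n : nat} {Z : T -> 'rV[R]_n}
    {f : 'rV[R]_n -> R} {p s delta eta rho r M : R} {x0 : 'rV[R]_n}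
    (a : 'rV[R]_n) :
  (forall U, open U -> measurable (Z @^-1` U)) -> continuous f ->
  (forall x, 0 <= f x <= 1) -> P (Z @^-1` [set x0]) = p%:E ->
  (forall x, delta <= `|x| -> f x <= p) ->
  (forall x, delta <= `|x| <= rho -> f x = 0) ->
  0 < s -> delta <= s * eta -> delta + s * M <= rho ->
  ('E_P[fun w => f (a + s *: Z w)%R] <=
    p%:E + P [set w | Z w != x0 /\ (`|Z w - - (s^-1 *: a)| < eta)%R] +
    P (outside_annulus Z x0 r M))%E.
Proof.
move=> mZ cf f01 pE f_off f_gap s0 delta_eta delta_rho.
have mA := measurable_preimage_set1 x0 mZ.
have mG := measurable_outside_annulus x0 r M mZ.
have mf := measurable_fun_payoff a s mZ cf.
have f_ge0 x : 0 <= f x by have /andP[] := f01 x.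
have f_le1 x : f x <= 1 by have /andP[] := f01 x.
have p0 : 0 <= p by rewrite -lee_fin -pE.
set G := outside_annulus Z x0 r M in mG *.
set H := [set w | _].
have mH : measurable H by exact: measurable_punctured_ball.
pose b := a + s *: x0.
have distE w : a + s *: Z w = b + s *: (Z w - x0).
  by rewrite /b scalerBr -addrA (addrC (s *: x0)) subrK.
have farH w : Z w != x0 -> ~ H w -> delta <= `|a + s *: Z w|.
  move=> Zx0 nHw; rewrite leNgt; apply/negP => small; apply: nHw; split => //.
  rewrite opprK -(ltr_pM2l s0) -[s in s * `|_|]gtr0_norm// -normrZ scalerDr.
  by rewrite scalerA divff ?gt_eqF// scale1r addrC; exact: lt_le_trans small _.
have [deltab|bdelta] := leP delta `|b|.
  apply: (@le_trans _ _ 'E_P[fun w => (cst p w + 1 * \1_H w)%R]%E).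
    apply: le_expectation => [||w]; [exact: mf|exact: measurable_funD_indic|].
    rewrite f_ge0/= mul1r indicE.
    have [Hw|] := boolP (w \in H); first by rewrite (le_trans (f_le1 _))// lerDr.
    rewrite notin_setE => nHw; rewrite addr0; apply: f_off.
    have [Zx0|] := eqVneq (Z w) x0; last by move=> /farH; apply.
    by rewrite Zx0.
  by rewrite expectationD_indic// expectation_cst mul1e leeDl.
apply: (@le_trans _ _
    'E_P[fun w => (cst 0 w + 1 * \1_((Z @^-1` [set x0] `|` H) `|` G) w)%R]%E).
  apply: le_expectation => [||w]; first exact: mf.
    apply: measurable_funD_indic => //.
    by apply: measurableU => //; apply: measurableU.
  rewrite f_ge0/= mul1r add0r indicE.
  have [Uw|] := boolP (w \in _); first exact: f_le1.
  rewrite notin_setE => /not_orP[/not_orP[/eqP Zx0 nHw] nGw].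
  rewrite le_eqVlt; apply/orP; left; apply/eqP.
  apply: f_gap; rewrite farH//= distE.
  have ZM : `|Z w - x0| <= M.
    rewrite leNgt; apply/negP => MZ; apply: nGw; split; last by right.
    by rewrite normr_gt0 subr_eq0.
  rewrite (le_trans (ler_normD _ _))// normrZ gtr0_norm//.
  by apply: le_trans delta_rho; rewrite lerD ?ler_pM2l// ltW.
rewrite expectationD_indic//; last by apply: measurableU => //; apply: measurableU.
rewrite expectation_cst add0e mul1e.
apply: le_trans (measureU2 P (measurableU _ _ mA mH) mG) _.
by apply: leeD => //; apply: le_trans (measureU2 P mA mH) _; rewrite -pE.
Qed.

Theorem theorem1p16 (d : measure_display) (Omega : measurableType d)
    (R : realType) (P : probability Omega R) (n : nat)
    (X : {RV P >-> borel_rV R n}) :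
  nondegenerate_dart X -> single_point_mass X ->
  exists f : 'rV[R]_n -> R,
    [/\ payoff f, (forall x, 0 <= f x), continuous f, compact_support f
      & ~ reasonable X f].
Proof.
move=> ndX [x0 [mass0 unique0]].
pose Z : Omega -> 'rV[R]_n := X.
have mZ U : open U -> measurable (Z @^-1` U).
  move=> oU; rewrite -[_ @^-1` _]setTI; apply: (measurable_funPT X) => //.
  exact: sub_sigma_algebra.
have mA := measurable_preimage_set1 x0 mZ.
have noatom x : x != x0 -> P (Z @^-1` [set x]) = 0%E.
  move=> xx0; apply/eqP; rewrite eq_le measure_ge0 andbT leNgt.
  by apply/negP => /unique0 /esym/eqP; apply/negP.
pose p := fine (P (Z @^-1` [set x0])).
have pE : P (Z @^-1` [set x0]) = p%:E by rewrite fineK// fin_num_measure.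
have p0 : 0 < p by rewrite -lte_fin -pE.
have p1 : p < 1.
  rewrite -lte_fin -pE lt_neqAle probability_le1// andbT.
  by apply/eqP => px0; apply: ndX; exists x0.
pose e := p * (1 - p) / 4.
have e0 : 0 < e by rewrite divr_gt0// mulr_gt0// subr_gt0.
have [r [M [r0 rM PG]]] := punctured_tail_small mZ x0 e e0 (P := P).
have M0 : 0 < M by exact: lt_le_trans rM.
(* Points at distance at most [M] from the atom get within [r / 4] of it, so
   that from inside the spike they stay below the radius [r / 2], where the
   plateau starts to rise. *)
pose s := r / (4 * M).
have s0 : 0 < s by rewrite divr_gt0// mulr_gt0.
have s1 : s <= 1 by rewrite ler_pdivrMr ?mulr_gt0//; lra.
have sM : s * M = r / 4 by rewrite /s; field; rewrite gt_eqF.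
have [delta0 delta0_gt0 Psmall] := small_ball x0 mZ noatom e e0.
(* At scale [s], the spike is a ball of radius at most [delta0] for [Z]. *)
pose delta := Num.min (r / 4) (s * delta0).
have delta_gt0 : 0 < delta by rewrite lt_min divr_gt0//= mulr_gt0.
have deltar : delta <= r / 4 by rewrite ge_min lexx.
have deltas : delta <= s * delta0 by rewrite ge_min lexx orbT.
pose phi := spike_and_hump p delta r M.
pose f (x : 'rV[R]_n) := phi `|x|.
have p01 : 0 <= p <= 1 by rewrite !ltW.
have f_ge0 x : 0 <= f x by exact: spike_and_hump_ge0.
have f_le1 x : f x <= 1 by exact: spike_and_hump_le1.
have cf : continuous f.
  move=> x; apply: (@continuous_comp _ _ _ (fun y : 'rV[R]_n => `|y|)).
    exact: norm_continuous.
  exact: continuous_spike_and_hump.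
exists f; split => //.
- split; last by exists 1 => _ [x _ <-].
  apply: (@measurable_fun_continuous_comp _ (borel_rV R n) R 'rV[R]_n id f _ cf).
  by move=> U oU; exact: sub_sigma_algebra.
- apply: bounded_closed_compact; last exact: closed_closure.
  exists (M + 1); split; first exact: num_real.
  have : closure [set x | f x != 0] `<=` [set x | `|x| <= M + 1].
    have cball : closed [set x : 'rV[R]_n | `|x| <= M + 1].
      rewrite (_ : [set _ | _] = Num.norm @^-1` `]-oo, M + 1]%classic).
        by apply: closed_comp => [y _|];
          [exact: norm_continuous|exact: interval_closed].
      by apply/seteqP; split => y /=; rewrite in_itv.
    rewrite [X in _ `<=` X](iffLR (closure_id _) cball).
    apply: closure_subset => y; apply: contra_neqP => /negP; rewrite -ltNge => My.
    by apply: spike_and_hump_far => //; lra.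
  by move=> sub y My x /sub xM; exact: le_trans xM (ltW My).
move=> /(_ s 1 s0 s1); apply/negP; rewrite -ltNge.
apply: (@le_lt_trans _ _ (p + e + e)%:E).
  apply: ge_ereal_sup => _ [a _ <-].
  apply: le_trans (fine_scale_payoff (rho := r / 2) (r := r) (M := M)
    a mZ cf _ pE _ _ s0 deltas _) _.
  - by move=> x; rewrite f_ge0 f_le1.
  - by move=> x; exact: spike_and_hump_le (ltW p0) delta_gt0.
  - by move=> x; exact: spike_and_hump_gap.
  - by rewrite sM; lra.
  by rewrite !EFinD; apply: leeD; [exact: leeD|exact: ltW].
apply: (@lt_le_trans _ _ 'E_P[fun w => f (- x0 + 1 *: Z w)%R]%E); last first.
  by apply: ereal_sup_ubound; exists (- x0).
have coarse := coarse_scale_payoff (P := P) (r := r) (M := M) x0 mZ cf f_ge0 p01.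
rewrite ltNge; apply/negP => Ef.
have {coarse} : (p%:E + (1 - p)%:E * P (Z @^-1` [set x0]) <= (p + e + e + e)%:E)%E.
  apply: le_trans (coarse _ _) _.
  - by rewrite /f normr0; exact: spike_and_hump0 (ltW p0) delta_gt0.
  - by move=> x; exact: spike_and_hump_annulus r0 (ltW p0).
  by rewrite [leRHS]EFinD; apply: leeD => //; exact: ltW.
apply/negP; rewrite -ltNge (_ : _ * _ = ((1 - p) * p)%:E)%E; last first.
  by rewrite EFinM -pE.
by rewrite -EFinD lte_fin /e; move: e0; rewrite /e; lra.
Qed.
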